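(* For $\omega_t,\alpha,\theta_t\in\mathbb{R}$ let $\hat{\mathcal S}(\omega_t,\alpha,\theta_t)\ge 0$ be defined by $$\big(\hat{\mathcal S}(\omega_t,\alpha,\theta_t)\big)^2 := (1-\omega_t)^2+2\omega_t(1-\omega_t)\,\alpha\cos(\theta_t)+\alpha^2\omega_t^2 .$$ Let $\omega_t^\ast=\frac12$. Then for every $\alpha\in\mathbb{R}$ $$\sup_{\theta_t\in[0,\pi]}\hat{\mathcal S}(\omega_t^\ast,\alpha,\theta_t)=\frac12\,(1+|\alpha|),$$ and the supremum is attained at $$\theta_t^\ast=\begin{cases}0,&\alpha\ge0,\\ \pi,&\alpha<0.\end{cases}$$
   Context: The quantity defining $\hat{\mathcal S}^2$ equals $|1-\omega_t+e^{-\mathrm{i}\theta_t}\omega_t\alpha|^2$ and is therefore nonnegative. *)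

(* Defs.v *)
From HB Require Import structures.
From mathcomp Require Import all_boot all_order all_algebra.
From mathcomp Require Import all_classical all_reals all_analysis.
From mathcomp Require Import ring.
Set Implicit Arguments.
Unset Strict Implicit.
Unset Printing Implicit Defensive.
Import Order.TTheory GRing.Theory Num.Theory.

Local Open Scope ring_scope.

Definition Shat2 {R : realType} (omega alpha theta : R) : R :=
  (1 - omega) ^+ 2 + 2 * omega * (1 - omega) * alpha * cos theta
  + alpha ^+ 2 * omega ^+ 2.

(* Num.sqrt is 0 on negative arguments; Shat2_ge0 shows that this case never
   arises, so that Shat is the nonnegative function whose square is Shat2. *)
Definition Shat {R : realType} (omega alpha theta : R) : R :=
  Num.sqrt (Shat2 omega alpha theta).

(* The right-hand side is |1 - omega + e^(-i theta) omega alpha|^2. *)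
Lemma Shat2E {R : realType} (omega alpha theta : R) :
  Shat2 omega alpha theta =
  (1 - omega + omega * alpha * cos theta) ^+ 2
  + (omega * alpha * sin theta) ^+ 2.
Proof. by rewrite /Shat2 [(_ * sin theta) ^+ 2]exprMn sin2cos2; ring. Qed.

Lemma Shat2_ge0 {R : realType} (omega alpha theta : R) :
  0 <= Shat2 omega alpha theta.
Proof. by rewrite Shat2E addr_ge0 ?sqr_ge0. Qed.

Lemma Shat_ge0 {R : realType} (omega alpha theta : R) :
  0 <= Shat omega alpha theta.
Proof. exact: sqrtr_ge0. Qed.

Lemma Shat_sqr {R : realType} (omega alpha theta : R) :
  Shat omega alpha theta ^+ 2 = Shat2 omega alpha theta.
Proof. exact/sqr_sqrtr/Shat2_ge0. Qed.

Definition omega_star {R : realType} : R := 1 / 2.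

Definition theta_star {R : realType} (alpha : R) : R :=
  if 0 <= alpha then 0 else pi.

(* Main.v *)
Require Import Defs.
From HB Require Import structures.
From mathcomp Require Import all_boot all_order all_algebra.
From mathcomp Require Import all_classical all_reals all_analysis.
From mathcomp Require Import ring lra.
Set Implicit Arguments.
Unset Strict Implicit.
Unset Printing Implicit Defensive.
Import Order.TTheory GRing.Theory Num.Theory.

Local Open Scope classical_set_scope.
Local Open Scope ring_scope.

(** At weight 1/2 the squared quantity is (1 + 2 alpha cos theta + alpha^2) / 4. Since alpha cos
    theta <= |alpha|, it is at most ((1 + |alpha|) / 2)^2 ([Shat_omega_star_le]), with equality once
    cos theta carries the sign of alpha, as at [theta_star] ([Shat_theta_star]). The bound is thus a
    maximum, hence the supremum. *)

Lemma Shat_omega_star_le (R : realType) (alpha theta : R) :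
  Shat omega_star alpha theta <= 1 / 2 * (1 + `|alpha|).
Proof.
have rhs_ge0 : 0 <= 1 / 2 * (1 + `|alpha|) by have := normr_ge0 alpha; lra.
rewrite -(ler_pXn2r (n := 2)) ?nnegrE ?Shat_ge0// Shat_sqr /Shat2 /omega_star.
have : alpha * cos theta <= `|alpha|.
  apply: le_trans (ler_norm _) _; rewrite normrM ler_piMr// ler_norml.
  by rewrite cos_geN1 cos_le1.
(* Given |alpha|^2 = alpha^2, the two squares differ by exactly (|alpha| - alpha cos theta) / 2. *)
have := real_normK (num_real alpha); nra.
Qed.

Lemma theta_star_in (R : realType) (alpha : R) :
  theta_star alpha \in `[0, pi].
Proof.
by rewrite /theta_star; case: ifP => _; rewrite in_itv/= ?lexx ?pi_ge0.
Qed.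

Lemma Shat_theta_star (R : realType) (alpha : R) :
  Shat omega_star alpha (theta_star alpha) = 1 / 2 * (1 + `|alpha|).
Proof.
have rhs_ge0 : 0 <= 1 / 2 * (1 + `|alpha|) by have := normr_ge0 alpha; lra.
apply/eqP; rewrite -(eqrXn2 (n := 2)) ?Shat_ge0// Shat_sqr /Shat2 /omega_star.
(* In both cases alpha cos([theta_star alpha]) = |alpha|, which turns the expression into a perfect
   square. *)
apply/eqP; rewrite /theta_star; case: ifPn => [a0|].
  by rewrite cos0 ger0_norm//; field.
by rewrite -ltNge => a0; rewrite cospi ltr0_norm//; field.
Qed.

Theorem lemma3p11 (R : realType) (alpha : R) :
  sup [set Shat omega_star alpha theta | theta in `[0, pi]]
    = 1 / 2 * (1 + `|alpha|)
  /\ theta_star alpha \in `[0, pi]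
  /\ Shat omega_star alpha (theta_star alpha)
     = sup [set Shat omega_star alpha theta | theta in `[0, pi]].
Proof.
set S := [set _ | _ in _].
have theta_in : theta_star alpha \in `[0, pi] := theta_star_in alpha.
have S_max : S (1 / 2 * (1 + `|alpha|)).
  by exists (theta_star alpha); [exact: theta_in | exact: Shat_theta_star].
have S_ub : ubound S (1 / 2 * (1 + `|alpha|)).
  by move=> _ [theta _ <-]; exact: Shat_omega_star_le.
have supE : sup S = 1 / 2 * (1 + `|alpha|).
  (* [sup] is only meaningful on a nonempty bounded set; the maximum itself witnesses nonemptiness
     here and boundedness in the converse inequality. *)
  apply/eqP; rewrite eq_le ge_sup//=; last by exists (1 / 2 * (1 + `|alpha|)).
  by apply: ub_le_sup => //; exists (1 / 2 * (1 + `|alpha|)).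
by rewrite supE; split=> //; split=> //; exact: Shat_theta_star.
Qed.
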